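(* Let $n,k\in\mathbb{N}$, let $I\subset\mathbb{R}$ be an interval, let $\mu\in\mathcal{CS}_n(I)$, let $M=(M_1,\dots,M_n)\in\mathcal{M}_k(I)^n$, and let $S\in\mathcal{E}(M)$. Then $\mathcal{T}_{S,M}(\mu)\in\mathcal{M}_k(I)$; that is, the function $\mathcal{T}_{S,M}(\mu)\colon I^k\to I$ is a symmetric, continuous $k$-variable mean on $I$.
   Context: $\mathbb{N}=\{1,2,\dots\}$. A $k$-variable mean on an interval $I$ is a function $M\colon I^k\to I$ with $\min(v)\le M(v)\le\max(v)$ for all $v\in I^k$; it is symmetric if its value is invariant under permutations of the entries of $v$. $\mathcal{M}_k(I)$ is the family of all symmetric, continuous $k$-variable means on $I$. $\mathcal{CS}_n(I)$ is the family of all continuous, symmetric functions $\mu\colon I^n\to\mathbb{R}$ that are strictly increasing in each variable. For a real vector $v$, $v^\uparrow$ (resp. $v^\downarrow$) denotes its nondecreasing (resp. nonincreasing) rearrangement. For $m\le n$, a vector $v\in\mathbb{R}^m$ is embedded in $w\in\mathbb{R}^n$, written $v\triangleleft w$, if $v^\downarrow_j\le w^\downarrow_j$ and $v^\uparrow_j\ge w^\uparrow_j$ for all $j\in\{1,\dots,m\}$. For tuples of real functions on a common domain $X$, $(f_1,\dots,f_m)\triangleleft(g_1,\dots,g_n)$ means $(f_1(x),\dots,f_m(x))\triangleleft(g_1(x),\dots,g_n(x))$ for all $x\in X$. For $M\in\mathcal{M}_k(I)^n$ put $\mathcal{E}_m(M)=\{S\in\mathcal{M}_k(I)^m : S\triangleleft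 M\}$ for $m\in\{1,\dots,n-1\}$, and $\mathcal{E}(M)=\bigcup_{m=1}^{n-1}\mathcal{E}_m(M)$. For $S\in\mathcal{E}_m(M)$ write $|S|=m$. For $\mu\in\mathcal{CS}_n(I)$, $M\in\mathcal{M}_k(I)^n$ and $S\in\mathcal{E}(M)$, the function $\mathcal{T}_{S,M}(\mu)\colon I^k\to I$ is defined by letting $\mathcal{T}_{S,M}(\mu)(v)$ be the (existing and unique) $x\in I$ solving $$\mu\big(S_1(v),\dots,S_{|S|}(v),\underbrace{x,\dots,x}_{(n-|S|)\text{ times}}\big)=\mu\big(M_1(v),\dots,M_n(v)\big).$$ *)

(* Defs.v *)
From mathcomp Require Import all_boot all_order all_algebra all_fingroup.
From mathcomp Require Import all_classical all_reals all_analysis.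

Set Implicit Arguments.
Unset Strict Implicit.
Unset Printing Implicit Defensive.

Import Order.TTheory GRing.Theory Num.Theory.
Import numFieldNormedType.Exports.

Local Open Scope classical_set_scope.
Local Open Scope ring_scope.

(* A function I^k -> R is represented by a function on all of R^k whose values
   outside of the cube I^k are never inspected; continuity is with respect to
   the subspace topology of I^k. *)
Definition cube (R : realType) (I : set R) (k : nat) : set 'rV[R]_k :=
  [set v | forall i, I (v 0 i)].

Definition entries (R : realType) (k : nat) (v : 'rV[R]_k) : seq R :=
  [seq v 0 i | i : 'I_k].

(* Junk value 0 on the empty sequence. *)
Definition seqmin (R : realType) (s : seq R) : R :=
  \big[Num.min/head 0 s]_(x <- s) x.

Definition seqmax (R : realType) (s : seq R) : R :=
  \big[Num.max/head 0 s]_(x <- s) x.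

Definition is_mean (R : realType) (I : set R) (k : nat)
    (f : 'rV[R]_k -> R) : Prop :=
  forall v, cube I v ->
    I (f v) /\ seqmin (entries v) <= f v <= seqmax (entries v).

Definition symmetric_on_cube (R : realType) (I : set R) (k : nat)
    (f : 'rV[R]_k -> R) : Prop :=
  forall (s : 'S_k) v, cube I v -> f (col_perm s v) = f v.

Definition strictly_increasing_in_each (R : realType) (I : set R) (k : nat)
    (f : 'rV[R]_k -> R) : Prop :=
  forall (i : 'I_k) v w, cube I v -> cube I w ->
    (forall j, j != i -> v 0 j = w 0 j) -> v 0 i < w 0 i -> f v < f w.

Definition sym_means (R : realType) (I : set R) (k : nat) :
    set ('rV[R]_k -> R) :=
  [set f | [/\ is_mean I f, symmetric_on_cube I f
             & {within cube I (k := k), continuous f}]].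

Definition cont_sym_incr (R : realType) (I : set R) (n : nat) :
    set ('rV[R]_n -> R) :=
  [set mu | [/\ {within cube I (k := n), continuous mu},
               symmetric_on_cube I mu
             & strictly_increasing_in_each I mu]].

Definition rearr_up (R : realType) (s : seq R) : seq R :=
  sort (fun x y => x <= y) s.

Definition rearr_down (R : realType) (s : seq R) : seq R :=
  sort (fun x y => y <= x) s.

Definition embedded (R : realType) (v w : seq R) : Prop :=
  (size v <= size w)%N /\
  forall j, (j < size v)%N ->
    (rearr_down v)`_j <= (rearr_down w)`_j /\ (rearr_up v)`_j >= (rearr_up w)`_j.

Definition values (R : realType) (k : nat) (fs : seq ('rV[R]_k -> R))
    (v : 'rV[R]_k) : seq R :=
  [seq f v | f <- fs].

Definition embeddings_of_size (R : realType) (I : set R) (k n : nat)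
    (M : n.-tuple ('rV[R]_k -> R)) (m : nat) :
    set (m.-tuple ('rV[R]_k -> R)) :=
  [set S | (forall i, sym_means I (tnth S i)) /\
           forall v, cube I v -> embedded (values S v) (values M v)].

(* The union over m is formed in the type of finite sequences of functions,
   so that |S| is size S. *)
Definition embeddings (R : realType) (I : set R) (k n : nat)
    (M : n.-tuple ('rV[R]_k -> R)) : set (seq ('rV[R]_k -> R)) :=
  \bigcup_(m in [set m : nat | (1 <= m <= n - 1)%N])
    [set tval S | S in embeddings_of_size I M (m := m)].

Definition row_of_seq (R : realType) (n : nat) (s : seq R) : 'rV[R]_n :=
  \row_(i < n) s`_i.

(* get P is an element of P if there is one, and a default real otherwise;
   for I an interval, mu in cont_sym_incr I, M a tuple of means, S in
   embeddings I M and v in the cube, P is a singleton. *)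
Definition transform (R : realType) (I : set R) (k n : nat)
    (S : seq ('rV[R]_k -> R)) (M : n.-tuple ('rV[R]_k -> R))
    (mu : 'rV[R]_n -> R) (v : 'rV[R]_k) : R :=
  get [set x : R | I x /\
    mu (row_of_seq n (values S v ++ nseq (n - size S) x)) =
    mu (row_of_seq n (values M v))].

(* Main.v *)
(* Padding S(v) with min M(v) gives a vector whose decreasing rearrangement lies
   below that of M(v), and padding with max M(v) one whose increasing
   rearrangement lies above; as mu is symmetric and increasing, the intermediate
   value theorem puts a solution between min M(v) and max M(v). For continuity
   at v, compare T with a fixed y near T(v): if y is in I, the strict inequality
   between mu(S, y, ..., y) and mu(M) at v persists on a neighbourhood and
   yields the same inequality between y and T; if y is not in I, no value of T
   can cross it because I is an interval. *)
Require Import Defs.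
From mathcomp Require Import all_boot all_order all_algebra all_fingroup.
From mathcomp Require Import all_classical all_reals all_analysis.

Set Implicit Arguments.
Unset Strict Implicit.
Unset Printing Implicit Defensive.

Import Order.TTheory GRing.Theory Num.Theory.
Import numFieldNormedType.Exports.

Local Open Scope classical_set_scope.
Local Open Scope ring_scope.

(** * Lists, rows, and monotone or continuous functions on the cube *)

Lemma seq_extrema (R : realType) (s : seq R) : s != [::] ->
  exists l u, [/\ l \in s, u \in s & forall x, x \in s -> l <= x <= u].
Proof.
elim: s => // x [|y s] IH _.
  by exists x, x; split; rewrite ?mem_head// => z; rewrite inE => /eqP->; rewrite lexx.
have [l [u [ls us h]]] := IH isT.
exists (Num.min x l), (Num.max x u); split.
- by rewrite inE; case: (leP x l) => _; rewrite ?eqxx ?ls ?orbT.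
- by rewrite inE; case: (leP x u) => _; rewrite ?eqxx ?us ?orbT.
- move=> z; rewrite inE => /orP[/eqP->|/h /andP[lz zu]].
    by rewrite ge_min lexx le_max lexx.
  by rewrite ge_min lz le_max zu !orbT.
Qed.

Lemma cube_row_of_seq (R : realType) (I : set R) (n : nat) (s : seq R) :
  size s = n -> (forall x, x \in s -> I x) -> cube I (row_of_seq n s).
Proof. by move=> sn sI i; rewrite mxE; apply/sI/mem_nth; rewrite sn. Qed.

(** A permutation of lists comes from a permutation of indices, to which the symmetry of [f]
    applies. Symmetry is available only on the cube, hence the condition on the entries of [t]. *)
Lemma row_of_seq_perm (R : realType) (I : set R) (n : nat) (f : 'rV[R]_n -> R)
    (s t : seq R) :
  symmetric_on_cube I f -> size t = n -> (forall x, x \in t -> I x) ->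
  perm_eq s t -> f (row_of_seq n s) = f (row_of_seq n t).
Proof.
move=> fS /eqP tn tI /(@tuple_permP _ _ s (Tuple tn))[p ->].
rewrite -(fS p (row_of_seq n t)); last exact: (cube_row_of_seq (eqP tn) tI).
congr f; apply/rowP => i; rewrite !mxE (nth_map i) ?size_enum_ord//.
by rewrite nth_ord_enum (tnth_nth 0).
Qed.

(** Replace the coordinates of [v] by those of [w] one at a time. The hybrid rows [h j] stay in the
    cube, since each of their entries comes from [v] or [w]; a step either changes nothing or
    strictly raises [f]. *)
Lemma strictly_increasing_le (R : realType) (I : set R) (n : nat)
    (f : 'rV[R]_n -> R) (v w : 'rV[R]_n) :
  strictly_increasing_in_each I f -> cube I v -> cube I w ->
  (forall i, v 0 i <= w 0 i) -> f v <= f w.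
Proof.
move=> fI Iv Iw vw.
pose h j : 'rV[R]_n := \row_i (if (i < j)%N then w 0 i else v 0 i).
have Ih j : cube I (h j) by move=> i; rewrite mxE; case: ifP.
have h0 : h 0%N = v by apply/rowP => i; rewrite mxE.
have hn : h n = w by apply/rowP => i; rewrite mxE ltn_ord.
suff H j : (j <= n)%N -> f v <= f (h j) by rewrite -hn H.
elim: j => [|j IH] jn; first by rewrite h0.
apply: (le_trans (IH (ltnW jn))); pose i := Ordinal jn.
have hij : h j 0 i = v 0 i by rewrite mxE ltnn.
have hiS : h j.+1 0 i = w 0 i by rewrite mxE ltnSn.
have hE m : m != i -> h j 0 m = h j.+1 0 m.
  by move=> mi; rewrite !mxE ltnS [(m <= j)%N]leq_eqVlt (negbTE (mi : (m : nat) != j)).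
have := vw i; rewrite le_eqVlt => /orP[/eqP e|lt].
  suff -> : h j = h j.+1 by [].
  by apply/rowP => m; have [->|/hE//] := eqVneq m i; rewrite hij hiS.
by apply/ltW/(fI i) => //; rewrite hij hiS.
Qed.

(** Raising coordinate [i] first gives the strict inequality; raising the others afterwards cannot
    lower [f]. *)
Lemma strictly_increasing_lt (R : realType) (I : set R) (n : nat)
    (f : 'rV[R]_n -> R) (v w : 'rV[R]_n) (i : 'I_n) :
  strictly_increasing_in_each I f -> cube I v -> cube I w ->
  (forall j, v 0 j <= w 0 j) -> v 0 i < w 0 i -> f v < f w.
Proof.
move=> fI Iv Iw vw vwi.
pose u : 'rV[R]_n := \row_j (if j == i then w 0 i else v 0 j).
have Iu : cube I u by move=> j; rewrite mxE; case: ifP.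
apply: (@lt_le_trans _ _ (f u)).
  apply: (fI i) => //; last by rewrite mxE eqxx.
  by move=> j ji; rewrite mxE (negbTE ji).
apply: (strictly_increasing_le fI) => // j.
by rewrite mxE; case: eqP => [->|].
Qed.

Lemma within_continuous_row (R : realType) (T : topologicalType) (A : set T)
    (I : set R) (n : nat) (f : 'rV[R]_n -> R) (s : T -> seq R) :
  {within cube I (k := n), continuous f} ->
  (forall t, A t -> size (s t) = n /\ forall x, x \in s t -> I x) ->
  (forall i, (i < n)%N -> {within A, continuous (fun t => (s t)`_i)}) ->
  {within A, continuous (fun t => f (row_of_seq n (s t)))}.
Proof.
move=> /subspace_continuousP fc As sc; pose g t := row_of_seq n (s t).
have Ag t : A t -> cube I (g t) by move=> /As[]; exact: cube_row_of_seq.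
have gc i : {within A, continuous (fun t => g t 0 i)}.
  have -> : (fun t => g t 0 i) = (fun t => (s t)`_i) by apply/funext => t; rewrite mxE.
  exact: sc.
apply/subspace_continuousP => t At.
(* A neighbourhood of a row contains a product of neighbourhoods [P 0 i] of its entries, so finitely
   many entrywise conditions suffice. *)
have gt := Ag _ At; move: (fc _ gt) => /= {}fc W /fc /= [P nP sP].
have H i : within A (nbhs t) [set u | P 0 i (g u 0 i)].
  by move/subspace_continuousP: (gc i) => /(_ t At); apply; exact: nP.
have {}H : within A (nbhs t) [set u | forall i, P 0 i (g u 0 i)].
  exact: (@filter_forall _ _ (fun i => [set u | P 0 i (g u 0 i)]) _ _ H).
apply: (@filterS _ (nbhs t) _ _ _ _ H) => u {}H Au; apply: sP => [i j|]; last exact: Ag.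
by rewrite (ord1 i); apply: H.
Qed.

(** * The equation in the padding value: bounds, monotonicity, existence of a root *)

Lemma embedded_bounds (R : realType) (I : set R) (n : nat) (f : 'rV[R]_n -> R)
    (a b : seq R) (l u : R) :
  symmetric_on_cube I f -> strictly_increasing_in_each I f ->
  size b = n -> embedded a b ->
  (forall x, x \in a -> I x) -> (forall x, x \in b -> I x) -> I l -> I u ->
  (forall x, x \in b -> l <= x <= u) ->
  f (row_of_seq n (a ++ nseq (n - size a) l)) <= f (row_of_seq n b)
    <= f (row_of_seq n (a ++ nseq (n - size a) u)).
Proof.
move=> fS fI bn [ab abE] aI bI lI uI lbu.
have an : (size a <= n)%N by rewrite -bn.
have padI x c : I c -> x \in a ++ nseq (n - size a) c -> I x.
  by move=> Ic; rewrite mem_cat => /orP[/aI//|/nseqP[->]].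
have padn c : size (a ++ nseq (n - size a) c) = n.
  by rewrite size_cat size_nseq subnKC.
(* Only [a] is sorted and the padding stays at the end. Comparison with sorted [b] is then
   entrywise: the embedding handles the first [size a] positions, and the bounds [l] and [u] handle
   the rest. *)
have sortn c r : size (sort r a ++ nseq (n - size a) c) = n.
  by rewrite size_cat size_nseq size_sort subnKC.
have permC c r :
    perm_eq (sort r a ++ nseq (n - size a) c) (a ++ nseq (n - size a) c).
  by rewrite perm_cat2r perm_sort.
have permE c r : I c -> f (row_of_seq n (sort r a ++ nseq (n - size a) c)) =
    f (row_of_seq n (a ++ nseq (n - size a) c)).
  by move=> Ic; apply: (row_of_seq_perm fS) => // x; exact: padI.
have permB r : f (row_of_seq n (sort r b)) = f (row_of_seq n b).
  by apply: (row_of_seq_perm fS) => //; rewrite perm_sort.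
have cubeA c r : I c ->
    cube I (row_of_seq n (sort r a ++ nseq (n - size a) c)).
  move=> Ic; apply: cube_row_of_seq => // x.
  by rewrite (perm_mem (permC _ _)); exact: padI.
have cubeB r : cube I (row_of_seq n (sort r b)).
  by apply: cube_row_of_seq; rewrite ?size_sort// => x; rewrite mem_sort; exact: bI.
have lbuE r (i : 'I_n) : l <= (sort r b)`_i <= u.
  by apply: lbu; rewrite -(mem_sort r) mem_nth// size_sort bn.
apply/andP; split.
  rewrite -(permE _ (fun x y => y <= x))// -(permB (fun x y => y <= x)).
  apply: (strictly_increasing_le fI); [exact: cubeA|exact: cubeB|] => i.
  rewrite !mxE nth_cat size_sort; case: ifPn => [/abE[]//|]; rewrite -leqNgt => ai.
  rewrite nth_nseq ltn_sub2r ?(leq_ltn_trans ai)//.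
  by case/andP: (lbuE (fun x y => y <= x) i).
rewrite -(permE _ (fun x y => x <= y))// -(permB (fun x y => x <= y)).
apply: (strictly_increasing_le fI); [exact: cubeB|exact: cubeA|] => i.
rewrite !mxE nth_cat size_sort; case: ifPn => [/abE[]//|]; rewrite -leqNgt => ai.
rewrite nth_nseq ltn_sub2r ?(leq_ltn_trans ai)//.
by case/andP: (lbuE (fun x y => x <= y) i).
Qed.

Lemma within_continuous_cst (T U : topologicalType) (A : set T) (c : U) :
  {within A, continuous (fun=> c)}.
Proof. by move=> t; exact: cst_continuous. Qed.

(** Index [size a] is the first padding slot; it exists because [a] is strictly shorter than [n],
    and the increase there is strict. This gives uniqueness of the root. *)
Lemma padded_lt (R : realType) (I : set R) (n : nat) (f : 'rV[R]_n -> R)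
    (a : seq R) (x y : R) :
  strictly_increasing_in_each I f -> (size a < n)%N ->
  (forall x, x \in a -> I x) -> I x -> I y -> x < y ->
  f (row_of_seq n (a ++ nseq (n - size a) x)) <
  f (row_of_seq n (a ++ nseq (n - size a) y)).
Proof.
move=> fI an aI xI yI xy.
have padI c : I c -> cube I (row_of_seq n (a ++ nseq (n - size a) c)).
  move=> Ic; apply: cube_row_of_seq; first by rewrite size_cat size_nseq subnKC// ltnW.
  by move=> z; rewrite mem_cat => /orP[/aI//|/nseqP[->]].
apply: (strictly_increasing_lt (i := Ordinal an) fI) => //; try exact: padI.
- move=> j; rewrite !mxE !nth_cat; case: ifP => // _.
  by rewrite !nth_nseq; case: ifP => // _; exact: ltW.
- by rewrite !mxE !nth_cat /= ltnn !nth_nseq subnn subn_gt0 an.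
Qed.

Lemma embedded_root (R : realType) (I : set R) (n : nat) (f : 'rV[R]_n -> R)
    (a b : seq R) (l u : R) :
  is_interval I -> cont_sym_incr I f ->
  size b = n -> embedded a b ->
  (forall x, x \in a -> I x) -> (forall x, x \in b -> I x) -> I l -> I u ->
  l <= u -> (forall x, x \in b -> l <= x <= u) ->
  exists x, [/\ I x, l <= x <= u &
    f (row_of_seq n (a ++ nseq (n - size a) x)) = f (row_of_seq n b)].
Proof.
move=> Iitv [fc fS fI] bn ab aI bI lI uI lu lbu.
have luI x : l <= x <= u -> I x by exact: Iitv.
have an : (size a <= n)%N by case: ab; rewrite bn.
have /andP[lo hi] := embedded_bounds fS fI bn ab aI bI lI uI lbu.
have [||x] := IVT (f := fun x => f (row_of_seq n (a ++ nseq (n - size a) x)))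
    (v := f (row_of_seq n b)) lu.
- apply: (within_continuous_row fc) => [x|i ilt].
    rewrite /= in_itv /= => /luI xI; split.
      by rewrite size_cat size_nseq subnKC.
    by move=> z; rewrite mem_cat => /orP[/aI//|/nseqP[->]].
  (* Each entry of the padded row is either constant or the variable itself. *)
  have [ia|ai] := ltnP i (size a).
    rewrite (_ : (fun _ => _) = (fun=> a`_i)); first exact: within_continuous_cst.
    by apply/funext => x; rewrite nth_cat ia.
  rewrite (_ : (fun _ => _) = id); first by apply: continuous_subspaceT => z; exact: cvg_id.
  by apply/funext => x; rewrite nth_cat ltnNge ai nth_nseq ltn_sub2r// (leq_ltn_trans ai).
- by rewrite ge_min lo le_max hi orbT.
- by rewrite in_itv /= => lxu fx; exists x; split=> //; exact: luI.
Qed.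

Theorem theorem3p1 (R : realType) (n k : nat) (hn : (0 < n)%N) (hk : (0 < k)%N)
    (I : set R) (hI : is_interval I)
    (mu : 'rV[R]_n -> R) (hmu : cont_sym_incr I mu)
    (M : n.-tuple ('rV[R]_k -> R)) (hM : forall i, sym_means I (tnth M i))
    (S : seq ('rV[R]_k -> R)) (hS : embeddings I M S) :
  sym_means I (transform I S M mu).
Proof.
have [muc muS muI] := hmu.
have [Sn [hSg emb]] : (size S < n)%N /\ (forall g, g \in S -> sym_means I g) /\
    forall v, cube I v -> embedded (values S v) (values M v).
  case: hS => m /andP[m0 mn] [S' [S'm S'emb] <-]; rewrite size_tuple.
  (* Here [n - 1] is truncated subtraction, so [0 < n] is what turns [m <= n - 1] into [m < n]. *)
  split; first by rewrite (leq_ltn_trans mn)// subn1 ltn_predL.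
  by split=> // g /tnthP[i ->].
have {}hM g : g \in M -> sym_means I g by move=> /tnthP[i ->].
have szM v : size (values M v) = n by rewrite size_map size_tuple.
have szS v : size (values S v) = size S by rewrite size_map.
have MI v x : cube I v -> x \in values M v -> I x.
  by move=> Iv /mapP[g /hM[gm _ _] ->]; case: (gm v Iv).
have SI v x : cube I v -> x \in values S v -> I x.
  by move=> Iv /mapP[g /hSg[gm _ _] ->]; case: (gm v Iv).
pose Phi x v := mu (row_of_seq n (values S v ++ nseq (n - size S) x)).
have Phi_lt v x y : cube I v -> I x -> I y -> x < y -> Phi x v < Phi y v.
  move=> Iv xI yI xy; rewrite /Phi -(szS v).
  by apply: (padded_lt muI) => //; rewrite ?szS// => z; exact: SI.
have T_spec v : cube I v ->
    [/\ I (transform I S M mu v),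
        seqmin (entries v) <= transform I S M mu v <= seqmax (entries v) &
        Phi (transform I S M mu v) v = mu (row_of_seq n (values M v))].
  move=> Iv; have [|l [u [lM uM lbu]]] := @seq_extrema R (values M v).
    by rewrite -size_eq0 szM -lt0n.
  have lu : l <= u by have /andP[] := lbu _ uM.
  have [x [xI /andP[lx xu]]] := embedded_root hI hmu (szM v) (emb v Iv)
    (fun x => @SI v x Iv) (fun x => @MI v x Iv) (MI _ _ Iv lM) (MI _ _ Iv uM) lu lbu.
  rewrite szS => xE.
  (* The bounds on the root [x] suffice: [l] and [u] are values at [v] of members of [M], which are
     means themselves. *)
  suff -> : transform I S M mu v = x.
    split=> //; apply/andP; split.
      apply: le_trans lx; case/mapP: lM => g /hM[gm _ _] ->.
      by case: (gm v Iv) => _ /andP[].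
    apply: (le_trans xu); case/mapP: uM => g /hM[gm _ _] ->.
    by case: (gm v Iv) => _ /andP[].
  (* Two distinct roots would contradict the strict monotonicity of [Phi] in its first argument. *)
  apply: get_unique => [//|y [yI yE]].
  have := Phi_lt v x y Iv xI yI; have := Phi_lt v y x Iv yI xI.
  rewrite /Phi xE yE ltxx.
  by case: (ltgtP y x) => // _ h1 h2; [have := h1 isT|have := h2 isT].
split=> [v /T_spec[]//|s v Iv|].
  (* The defining equation sees [v] only through the values of [S] and [M], all invariant under
     [s]. *)
  rewrite /transform.
  have valuesE (fs : seq ('rV[R]_k -> R)) : (forall g, g \in fs -> sym_means I g) ->
      values fs (col_perm s v) = values fs v.
    by move=> fsI; apply/eq_in_map => g /fsI[_ gS _]; exact: gS.
  by rewrite !valuesE.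
have Phi_cont x : I x -> {within cube I (k := k), continuous (Phi x)}.
  move=> xI; apply: (within_continuous_row muc) => [v Iv|i ilt].
    split; first by rewrite size_cat size_nseq szS subnKC// ltnW.
    by move=> z; rewrite mem_cat => /orP[/SI|/nseqP[->]]; [exact|].
  have [iS|Si] := ltnP i (size S).
    rewrite (_ : (fun _ => _) = nth (fun=> 0) S i).
      by have [] := hSg _ (mem_nth (fun=> 0) iS).
    by apply/funext => v; rewrite nth_cat szS iS (nth_map (fun=> 0)).
  rewrite (_ : (fun _ => _) = (fun=> x)); first exact: within_continuous_cst.
  apply/funext => v.
  by rewrite nth_cat szS ltnNge Si nth_nseq ltn_sub2r// (leq_ltn_trans Si).
have muM_cont : {within cube I (k := k),
    continuous (fun v => mu (row_of_seq n (values M v)))}.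
  apply: (within_continuous_row muc) => [v Iv|i ilt].
    by split=> // z; exact: MI.
  rewrite (_ : (fun _ => _) = nth (fun=> 0) M i).
    by have [] : sym_means I (nth (fun=> 0) M i) by apply: hM; rewrite mem_nth ?size_tuple.
  by apply/funext => v; rewrite (nth_map (fun=> 0)) ?size_tuple.
have near_sep f g v : {within cube I (k := k), continuous f} ->
    {within cube I (k := k), continuous g} -> cube I v -> f v < g v ->
    \forall w \near within (cube I (k := k)) (nbhs v), (f w < g w :> R).
  move=> /subspace_continuousP fc /subspace_continuousP gc Iv fg.
  (* The midpoint of [f v] and [g v] separates the two functions near [v]. *)
  have [fm mg] := midf_lt fg.
  apply: filterS2 (cvgr_lt _ (fc v Iv) _ fm) (cvgr_gt _ (gc v Iv) _ mg).
  by move=> w; apply: lt_trans.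
pose T := transform I S M mu.
have T_lt v y : cube I v -> T v < y ->
    \forall w \near within (cube I (k := k)) (nbhs v), T w < y.
  move=> Iv Ty; have [TI _ TE] := T_spec v Iv.
  (* [Phi_lt] and [Phi_cont] need [y] in [I], but a bound such as [T v + e] may fall outside it. *)
  have [yI|yI] := pselect (I y).
    have := Phi_lt v _ _ Iv TI yI Ty; rewrite TE.
    move=> /(near_sep _ _ _ muM_cont (Phi_cont y yI) Iv).
    apply: (@filterS _ (nbhs v)) => w ltw Iw; move: (ltw Iw).
    (* Writing the value of [mu] at [M] as [Phi (T w) w] makes both sides values of [Phi] at [w], so
       strict monotonicity carries the inequality back to [T w] and [y]. *)
    have [TwI _ <-] := T_spec w Iw.
    by case: (ltgtP (T w) y) => // [/(Phi_lt w _ _ Iw yI TwI)/lt_gtF->//|<-]; rewrite ltxx.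
  apply: (@nearW _ (nbhs v)) => w Iw; rewrite ltNge; apply: contra_notN yI => yTw.
  by apply: (hI (T v) (T w)) => //; [case: (T_spec w Iw)|rewrite (ltW Ty)].
have T_gt v y : cube I v -> y < T v ->
    \forall w \near within (cube I (k := k)) (nbhs v), y < T w.
  move=> Iv Ty; have [TI _ TE] := T_spec v Iv.
  have [yI|yI] := pselect (I y).
    have := Phi_lt v _ _ Iv yI TI Ty; rewrite TE.
    move=> /(near_sep _ _ _ (Phi_cont y yI) muM_cont Iv).
    apply: (@filterS _ (nbhs v)) => w ltw Iw; move: (ltw Iw).
    have [TwI _ <-] := T_spec w Iw.
    by case: (ltgtP y (T w)) => // [/(Phi_lt w _ _ Iw TwI yI)/lt_gtF->//|->]; rewrite ltxx.
  apply: (@nearW _ (nbhs v)) => w Iw; rewrite ltNge; apply: contra_notN yI => yTw.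
  by apply: (hI (T w) (T v)) => //; [case: (T_spec w Iw)|rewrite yTw (ltW Ty)].
(* Continuity follows from the two one-sided bounds with [y] equal to [T v + e] and [T v - e]. *)
apply/subspace_continuousP => v Iv; apply/cvgrPdist_lt => e e0.
have v1 : T v < T v + e by rewrite ltrDl.
have v2 : T v - e < T v by rewrite ltrBlDr ltrDl.
apply: filterS2 (T_lt v _ Iv v1) (T_gt v _ Iv v2) => w w1 w2.
by rewrite distrC ltr_distl w1 w2.
Qed.
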